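(* Define the $\mathbf Z$-linear map $\psi:MPR\to NSymm$ on permutation words by $\psi(\sigma)=0$ if $\sigma$ is not lsd and $\psi(\sigma)=R_{\mathrm{comp}(\mathrm{desc}(\sigma))}$ if $\sigma$ is lsd (with $\psi$ of the empty word equal to $1$). Then $\psi$ is a morphism of algebras $(MPR,m')\to NSymm$ and $\psi\circ i=\mathrm{id}_{NSymm}$, i.e. $\psi$ is an algebra retraction of the injective Hopf algebra morphism $i:NSymm\to(MPR,m',\mu')$.
   Context: A permutation word of length $n$ is a word $[s_1,\dots,s_n]$ over $\mathbf N$ in which each of $1,\dots,n$ occurs once; $S_n$ is the set of these; the empty word is the unique one of length $0$. $\mathrm{desc}(\sigma)=\{i\in\{1,\dots,n-1\}:s_i>s_{i+1}\}$. $\sigma\in S_n$ is lsd if it is the lexicographically smallest element of $\{\tau\in S_n:\mathrm{desc}(\tau)=\mathrm{desc}(\sigma)\}$. A composition of $n$ is a word $\alpha=[a_1,\dots,a_r]$ over $\mathbf N$ with sum $n$; $\mathrm{desc}(\alpha)=\{a_1,a_1+a_2,\dots,a_1+\dots+a_{r-1}\}\subset\{1,\dots,n-1\}$; for $D=\{d_1<\dots<d_{r-1}\}\subset\{1,\dots,n-1\}$, $\mathrm{comp}(D)=[d_1,d_2-d_1,\dots,n-d_{r-1}]$ (inverse to $\mathrm{desc}$). $(MPR,m',\mu')$: free abelian group on all permutation words, unit the empty word; for $\sigma\in S_m,\tau\in S_n$, $m'(\sigma\otimes\tau)=\sum u*v$ over all pairs of words $u,v$ over $\mathbf N$ with $\mathrm{supp}(u)\cup\mathrm{supp}(v)=\{1,\dots,m+n\}$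 (disjointly), $\mathrm{st}(u)=\sigma$, $\mathrm{st}(v)=\tau$, where $*$ is concatenation, $\mathrm{supp}$ the set of letters, and $\mathrm{st}$ relabels the letters of a repetition-free word by $1,\dots,\text{length}$ order-preservingly; $\mu'(\tau)=\sum_{i=0}^n\tau_{\{1,\dots,i\}}\otimes\mathrm{st}(\tau_{\{i+1,\dots,n\}})$, $\tau_I$ keeping only the letters in $I$. $NSymm=\mathbf Z\langle Z_1,Z_2,\dots\rangle$ with $\mu(Z_n)=\sum_{i+j=n}Z_i\otimes Z_j$ ($Z_0=1$); $S_0=1$ and $\sum_{i=0}^n(-1)^iS_{n-i}Z_i=0$ for $n\ge1$; $S_\beta=S_{b_1}\cdots S_{b_k}$; $\alpha\ge\beta$ means the composition $\alpha$ refines $\beta$ ($\beta$ obtained by adding consecutive blocks of entries of $\alpha$); $R_\alpha=\sum_{\beta\le\alpha}(-1)^{\mathrm{lg}(\alpha)-\mathrm{lg}(\beta)}S_\beta$. These form a basis with $R_{[a_1,\dots,a_m]}R_{[b_1,\dots,b_n]}=R_{[a_1,\dots,a_m,b_1,\dots,b_n]}+R_{[a_1,\dots,a_{m-1},a_m+b_1,b_2,\dots,b_n]}$. $i:NSymm\to(MPR,m',\mu')$ is the injective Hopf algebra morphism determined by $i(S_n)=[1,2,\dots,n]$; it satisfies $i(R_\alpha)=\sum_{\sigma\in S_n,\ \mathrm{desc}(\sigma)=\mathrm{desc}(\alpha)}\sigma$ for $\alpha$ a composition of $n$. *)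

(* Defs.v *)
From HB Require Import structures.
From mathcomp Require Import all_boot all_order all_algebra.
From mathcomp Require Import finmap.
From mathcomp.multinomials Require Import monalg.

Set Implicit Arguments.
Unset Strict Implicit.
Unset Printing Implicit Defensive.

Import Order.TTheory GRing.Theory Num.Theory.
Local Open Scope ring_scope.

Definition is_permword (w : seq nat) : bool := perm_eq w (iota 1 (size w)).

Definition permword := {w : seq nat | is_permword w}.

(* desc(s) = { i in {1..n-1} : s_i > s_{i+1} }  (1-indexed positions),
   represented as an increasing list. *)
Definition desc (s : seq nat) : seq nat :=
  [seq i <- iota 1 (size s).-1 | (nth 0 s i.-1 > nth 0 s i)%N].

Fixpoint lexle (s t : seq nat) : bool :=
  match s, t with
  | [::], _ => true
  | _ :: _, [::] => false
  | x :: s', y :: t' => (x < y)%N || ((x == y) && lexle s' t')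
  end.

Definition Sn (n : nat) : seq (seq nat) := permutations (iota 1 n).

Definition lsd (s : seq nat) : bool :=
  all (fun t => lexle s t) [seq t <- Sn (size s) | desc t == desc s].

(* comp(D) for D = {d_1 < ... < d_{r-1}} subset of {1..n-1}:
   [d_1, d_2 - d_1, ..., n - d_{r-1}]; comp of the empty set for n = 0 is
   the empty composition. *)
Definition compD (n : nat) (D : seq nat) : seq nat :=
  if n is 0 then [::] else pairmap (fun a b => b - a)%N 0%N (rcons D n).

(* standardization of a repetition-free word: each letter x is replaced by
   the number of letters <= x, i.e. relabel by 1..length order-preservingly *)
Definition st (u : seq nat) : seq nat :=
  [seq count (fun y => y <= x)%N u | x <- u].

Fixpoint words (k : nat) (L : seq nat) : seq (seq nat) :=
  if k is k'.+1 then [seq x :: w | x <- L, w <- words k' L] else [:: [::]].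

Definition MPR := {malg int[permword]}.

(* the basis element of MPR given by a word (0 if it is not a permutation
   word; only ever applied to permutation words) *)
Definition mkw (w : seq nat) : MPR :=
  if @insub _ is_permword permword w is Some p then << p >> else 0.

Definition mpr1 : MPR := mkw [::].

(* The pairs (u, v) of words over N with supp(u) and supp(v) disjoint of
   union {1..m+n}, st(u) = s, st(v) = t; and the list of their concatenations
   u * v.  (Such u, v necessarily have letters in {1..m+n}, lengths m, n.) *)
Definition mprod_terms (s t : seq nat) : seq (seq nat) :=
  let N := (size s + size t)%N in
  [seq uv.1 ++ uv.2 |
     uv <- [seq (u, v) | u <- words (size s) (iota 1 N),
                         v <- words (size t) (iota 1 N)]
     & [&& perm_eq (uv.1 ++ uv.2) (iota 1 N), st uv.1 == s & st uv.2 == t]].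

Definition mprod_basis (s t : permword) : MPR :=
  \sum_(w <- mprod_terms (val s) (val t)) mkw w.

Definition mprmul (x y : MPR) : MPR :=
  \sum_(s <- msupp x) \sum_(t <- msupp y) (x@_s * y@_t) *: mprod_basis s t.

(* NSymm = Z<Z_1, Z_2, ...> : the monoid algebra of the free monoid.    *)
(* The letter k of the free monoid {fmonom nat} stands for Z_{k+1}.     *)

Definition NSymm := {malg int[{fmonom nat}]}.

Definition Zg (n : nat) : NSymm :=
  if n is k.+1 then << fmu k >> else 1.

(* S_0 = 1 and sum_{i=0}^n (-1)^i S_{n-i} Z_i = 0 for n >= 1, i.e.
   S_n = sum_{i=1}^n (-1)^(i+1) S_{n-i} Z_i.
   Sseq n = [:: S_n; S_(n-1); ...; S_0]. *)
Fixpoint Sseq (n : nat) : seq NSymm :=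
  if n is n'.+1 then
    let l := Sseq n' in
    (\sum_(j < n'.+1) (-1) ^+ j * nth 0 l j * Zg j.+1) :: l
  else [:: 1].

Definition Sg (n : nat) : NSymm := head 0 (Sseq n).

Definition Scomp (b : seq nat) : NSymm := \prod_(x <- b) Sg x.

Fixpoint coarsenings (a : seq nat) : seq (seq nat) :=
  match a with
  | [::] => [:: [::]]
  | x :: a' =>
      flatten [seq (if b is y :: b' then [:: x :: b; (x + y)%N :: b']
                    else [:: [:: x]]) | b <- coarsenings a']
  end.

Definition Rg (a : seq nat) : NSymm :=
  \sum_(b <- coarsenings a) (-1) ^+ (size a - size b) * Scomp b.

Definition psi_basis (s : permword) : NSymm :=
  if lsd (val s) then Rg (compD (size (val s)) (desc (val s))) else 0.

Definition psi (x : MPR) : NSymm := \sum_(s <- msupp x) x@_s *: psi_basis s.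

(* Main.v *)
Require Import Defs.
From HB Require Import structures.
From mathcomp Require Import all_boot all_order all_algebra.
From mathcomp Require Import finmap zify.
From mathcomp.multinomials Require Import monalg.
Import GRing.Theory.

Set Implicit Arguments.
Unset Strict Implicit.

(** The lexicographically smallest permutation with a given descent set is the
    layered one, i.e. the direct sum of decreasing words: two positions are
    inverted only if they lie in a common decreasing run. Layeredness passes to
    factors, and a layered permutation is determined by its descent set. Hence
    m'(s, t) contains an lsd word only if s and t are both lsd, and then exactly
    two of them, one with a descent and one without at the junction of s and t;
    these are the two terms of the ribbon product R_a R_b. Finally psi o i is a
    ring endomorphism of NSymm fixing every S_n, and the S_n generate NSymm. *)

(** * Descents and the lexicographic order *)

(** Positions count from 0 here and from 1 in [desc]: inside the word, [descent w i] says that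
    [i.+1] is in [desc w]. *)
Definition descent (w : seq nat) (i : nat) : bool := nth 0 w i.+1 < nth 0 w i.

Definition layered (w : seq nat) : Prop :=
  forall i j, i < j < size w -> nth 0 w j < nth 0 w i ->
  forall k, i <= k < j -> descent w k.

Lemma mem_desc (s : seq nat) i :
  (i \in desc s) = (0 < i < size s) && descent s i.-1.
Proof.
rewrite mem_filter mem_iota andbC /descent; case: i => [|i] //=.
by congr (_ && _); lia.
Qed.

Lemma eq_descP (s t : seq nat) : size s = size t ->
  desc s = desc t <-> forall i, i.+1 < size s -> descent s i = descent t i.
Proof.
move=> eq_sz; split=> [eq_d i lt_i|eq_d].
  have := mem_desc s i.+1; have := mem_desc t i.+1.
  by rewrite eq_d -eq_sz /= lt_i /= => ->.
rewrite /desc -eq_sz; apply: eq_in_filter => -[|i]; rewrite mem_iota //= => lt_i.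
by apply: eq_d; lia.
Qed.

Lemma lexle_anti : antisymmetric lexle.
Proof.
move=> s t; elim: s t => [|x s IHs] [|y t] //= /andP[].
case: ltngtP => //= -> le_st le_ts; congr cons; apply: IHs.
by rewrite le_st.
Qed.

Lemma lexle_nth (s t : seq nat) : size s = size t ->
  (forall p, p < size s -> (forall j, j < p -> nth 0 s j = nth 0 t j) ->
     nth 0 s p <= nth 0 t p) ->
  lexle s t.
Proof.
elim: s t => [|x s IHs] [|y t] //= [eq_sz] le_st.
have := le_st 0 isT (fun j (h : j < 0) => False_ind _ (notF h)).
rewrite leq_eqVlt => /orP[/eqP /= eq_xy|/= ->] //.
rewrite eq_xy eqxx orbC /=; apply/orP; left; apply: IHs => // p lt_p eq_j.
by apply: (le_st p.+1) => // -[|j] //= lt_j; apply: eq_j.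
Qed.

Lemma sub_in_count (T : eqType) (a1 a2 : pred T) (s : seq T) :
  {in s, forall x, a1 x -> a2 x} -> count a1 s <= count a2 s.
Proof.
move=> sub12; rewrite (@eq_in_count _ a1 (predI a1 a2)).
  by apply: sub_count => x /andP[].
by move=> x /sub12 /=; case: (a1 x) => // ->.
Qed.

(** * Permutation words and standardization *)

Lemma permword_uniq w : is_permword w -> uniq w.
Proof. by move/perm_uniq->; apply: iota_uniq. Qed.

Lemma mem_permword w x : is_permword w -> (x \in w) = (0 < x <= size w).
Proof. by move/perm_mem->; rewrite mem_iota add1n. Qed.

Lemma count_leq_iota n x : x <= n -> count (fun y => y <= x) (iota 1 n) = x.
Proof.
move=> le_xn; rewrite -{1}(subnKC le_xn) iotaD count_cat.
rewrite (@eq_in_count _ _ predT) ?count_predT ?size_iota; last first.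
  by move=> y; rewrite mem_iota /=; lia.
rewrite (@eq_in_count _ _ pred0) ?count_pred0 ?addn0 //.
by move=> y; rewrite mem_iota /=; lia.
Qed.

Lemma permword_count w x : is_permword w -> x \in w ->
  count (fun y => y <= x) w = x.
Proof.
move=> pw wx; move: (pw) => /permP ->; apply: count_leq_iota.
by move: wx; rewrite mem_permword // => /andP[].
Qed.

Lemma permwordP w :
  reflect (uniq w /\ forall x, x \in w -> 0 < x <= size w) (is_permword w).
Proof.
apply: (iffP idP) => [pw|[Uw wP]].
  by split=> [|x]; rewrite ?permword_uniq // mem_permword.
have sub : {subset w <= iota 1 (size w)}.
  by move=> x /wP; rewrite mem_iota add1n.
have [eq_m] := uniq_min_size Uw sub (eq_leq (size_iota _ _)).
by move=> eq_w; apply: uniq_perm; rewrite ?iota_uniq.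
Qed.

Lemma size_st u : size (st u) = size u.
Proof. exact: size_map. Qed.

Lemma nth_st u i : i < size u ->
  nth 0 (st u) i = count (fun y => y <= nth 0 u i) u.
Proof. by move=> lt_i; rewrite (nth_map 0). Qed.

Lemma st_permword_id w : is_permword w -> st w = w.
Proof.
move=> pw; rewrite -[RHS]map_id; apply/eq_in_map => x wx.
exact: permword_count.
Qed.

(** If [u_i < u_j], the two counts differ by the letters in the interval from [u_i] (excluded) to
    [u_j], and [u_j] is one of them. *)
Lemma st_ltn u i j : i < size u -> j < size u ->
  (nth 0 (st u) i < nth 0 (st u) j) = (nth 0 u i < nth 0 u j).
Proof.
move=> lt_i lt_j; rewrite !nth_st //.
have [lt_ij|le_ji] := ltnP (nth 0 u i) (nth 0 u j); last first.
  by apply/negbTE; rewrite -leqNgt; apply: sub_count => y /= /leq_trans->.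
have := count_predUI (fun y => y <= nth 0 u i)
  (fun y => nth 0 u i < y <= nth 0 u j) u.
rewrite (@eq_count _ (predI _ _) pred0) ?count_pred0 => [|y /=]; last lia.
rewrite addn0 (@eq_count _ _ (fun y => y <= nth 0 u j)) => [->|y /=]; last lia.
rewrite -[X in X < _]addn0 ltn_add2l -has_count; apply/hasP.
by exists (nth 0 u j); rewrite ?mem_nth // lt_ij /=.
Qed.

Lemma st_permword u : uniq u -> is_permword (st u).
Proof.
move=> Uu; apply/permwordP; rewrite size_st; split.
  apply/(uniqP 0) => i j; rewrite !inE size_st => lt_i lt_j eq_ij.
  have := st_ltn lt_i lt_j; have := st_ltn lt_j lt_i.
  rewrite eq_ij ltnn => /esym/negbT; rewrite -leqNgt => le_ij.
  move=> /esym/negbT; rewrite -leqNgt => le_ji.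
  by apply/eqP; rewrite -(nth_uniq 0 lt_i lt_j Uu) eqn_leq le_ij.
move=> x /mapP[y uy ->]; rewrite count_size andbT -has_count.
by apply/hasP; exists y.
Qed.

Lemma descent_st u i : i.+1 < size u -> descent (st u) i = descent u i.
Proof. by move=> lt_i; rewrite /descent st_ltn // ltnW. Qed.

(** * Layered words: factors and minimality *)

Lemma layered_st u : layered u -> layered (st u).
Proof.
move=> Lu i j; rewrite size_st => /andP[lt_ij lt_j].
rewrite st_ltn ?(ltn_trans lt_ij) // => lt_u k /andP[le_ik lt_kj].
rewrite descent_st; first by apply: (Lu i j) => //; apply/andP.
exact: leq_ltn_trans lt_j.
Qed.

Lemma layered_take m w : layered w -> layered (take m w).
Proof.
move=> Lw i j; rewrite size_take_min leq_min => /and3P[lt_ij lt_jm lt_j].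
rewrite !nth_take ?(ltn_trans lt_ij) // => lt_w k /andP[le_ik lt_kj].
rewrite /descent !nth_take; [|lia..].
by apply: (Lw i j) => //; apply/andP.
Qed.

Lemma layered_drop m w : layered w -> layered (drop m w).
Proof.
move=> Lw i j; rewrite size_drop !nth_drop => lt_ij lt_w k lt_k.
rewrite /descent !nth_drop addnS; apply: (Lw (m + i) (m + j)) => //; lia.
Qed.

(* At the first position [p] where [t] drops below [w], [t_p] is a letter [w_k]
   with [k] further down the decreasing run of [p]; every letter of [w] below
   [w_p] is then below [t_p] in [t], which forces [w_p <= t_p]. *)
Lemma layered_lexle w t : is_permword w -> is_permword t -> size w = size t ->
  desc w = desc t -> layered w -> lexle w t.
Proof.
move=> pw pt eq_sz /(eq_descP eq_sz) eq_d Lw.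
apply: lexle_nth => // p lt_p eq_j; rewrite leqNgt; apply/negP => lt_tw.
have lt_p' : p < size t by rewrite -eq_sz.
have Uw := permword_uniq pw; have Ut := permword_uniq pt.
have : nth 0 t p \in w.
  by rewrite mem_permword // eq_sz -mem_permword // mem_nth.
case/(nthP 0) => k lt_k wk.
have lt_pk : p < k.
  rewrite ltnNge leq_eqVlt; apply/negP => /orP[/eqP eq_kp|lt_kp].
    by move: lt_tw; rewrite -wk eq_kp ltnn.
  have := wk; rewrite eq_j // => /eqP; rewrite nth_uniq -?eq_sz //.
  by move/eqP=> eq_kp; rewrite eq_kp ltnn in lt_kp.
have chain l : p <= l < k -> descent w l.
  by apply: Lw; rewrite ?lt_pk // wk.
have : nth 0 w p <= nth 0 t p; last by rewrite leqNgt lt_tw.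
(* A letter of a permutation word is the number of letters not exceeding it. Counting positions, it
   suffices that [w_l <= w_p] implies [t_l <= t_p]. *)
rewrite -(permword_count pw (mem_nth 0 lt_p)).
rewrite -(permword_count pt (mem_nth 0 lt_p')).
rewrite -[in X in count _ X <= _](mkseq_nth 0 w).
rewrite -[in X in _ <= count _ X](mkseq_nth 0 t) /mkseq !count_map -eq_sz.
apply: sub_in_count => l; rewrite mem_iota add0n /= => lt_l le_wl.
have [lt_lp|lt_pl|->//] := ltngtP l p; last first.
  (* Case [p < l]: the inversion puts [p] and [l] in one decreasing run of [w], hence of [t], and
     [t] decreases from [p] to [l]. *)
  have lt_wl : nth 0 w l < nth 0 w p.
    by rewrite ltn_neqAle le_wl nth_uniq // gtn_eqF.
  have {}chain q : p <= q < l -> descent t q.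
    move=> lt_q; rewrite -eq_d; last lia.
    by apply: (Lw p l) => //; rewrite lt_pl.
  elim: l lt_pl {lt_l le_wl lt_wl} chain => // l IHl.
  rewrite ltnS leq_eqVlt => /orP[/eqP <-|lt_pl] chain.
    by apply: ltnW; apply: chain; rewrite leqnn ltnSn.
  apply: leq_trans (IHl lt_pl _); last by move=> q lt_q; apply: chain; lia.
  by apply: ltnW; apply: chain; lia.
(* Case [l < p]: here [t_l = w_l] and [t_p = w_k]. If [w_k < w_l], then [w] decreases from [l] to
   [k], passing through [p], against [w_l <= w_p]. *)
rewrite -eq_j // -wk leqNgt; apply/negP => lt_kl.
have chain' q : l <= q < k -> descent w q.
  by apply: Lw; rewrite ?(ltn_trans lt_lp).
suff: nth 0 w p < nth 0 w l by lia.
elim: p lt_lp {lt_p eq_j lt_tw lt_p' wk chain le_wl lt_kl} lt_pk => // p IHp.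
rewrite ltnS leq_eqVlt => /orP[/eqP eq_lp|lt_lp] lt_pk.
  by rewrite -eq_lp in lt_pk *; apply: chain'; lia.
by apply: ltn_trans (IHp lt_lp _); [apply: chain'|]; lia.
Qed.

Lemma layered_inj w t : is_permword w -> is_permword t -> size w = size t ->
  desc w = desc t -> layered w -> layered t -> w = t.
Proof.
move=> pw pt eq_sz eq_d Lw Lt; apply: lexle_anti.
by rewrite !layered_lexle.
Qed.

(** * The layered permutation with prescribed descents *)

(* [head 0 v] is the length of the first decreasing run of a layered word [v];
   a descent in front of [v] lengthens that run by one. *)
Fixpoint layered_word (ds : seq bool) : seq nat :=
  if ds is d :: ds' then
    let v := layered_word ds' in
    let c := if d then (head 0 v).+1 else 1 in
    c :: map (bump c) v
  else [:: 1].

Lemma size_layered_word ds : size (layered_word ds) = (size ds).+1.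
Proof. by elim: ds => //= d ds IHds; rewrite size_map IHds. Qed.

Lemma layered_word_permword ds : is_permword (layered_word ds).
Proof.
elim: ds => //= d ds IHds; set v := layered_word ds in IHds *.
set c := if d then _ else 1.
have sz_v : size v = (size ds).+1 by apply: size_layered_word.
have c_bnd : 0 < c <= (size v).+1.
  rewrite /c; case: (d) => //=; rewrite ltnS -nth0.
  by have := mem_permword (nth 0 v 0) IHds; rewrite mem_nth ?sz_v //; lia.
apply/permwordP; rewrite /= size_map; split.
  rewrite map_inj_uniq ?permword_uniq ?andbT //; last exact: can_inj (bumpK c).
  by apply/mapP => -[y _]; rewrite /bump; lia.
move=> x; rewrite inE => /orP[/eqP->//|/mapP[y]].
by rewrite mem_permword // /bump => y_bnd ->; lia.
Qed.

(** With a descent, [c] is [v_0 + 1] and [bump c] leaves [v_0] below it; without one, [c = 1] and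
    [bump c] lifts all of [v] above it. Elsewhere [bump c] preserves the order. *)
Lemma descent_layered_word ds i : i < size ds ->
  descent (layered_word ds) i = nth false ds i.
Proof.
elim: ds i => //= d ds IHds i lt_i.
have sz_v : size (layered_word ds) = (size ds).+1 by apply: size_layered_word.
have pv := layered_word_permword ds.
set v := layered_word ds in IHds sz_v pv *; set c := if d then _ else 1.
case: i lt_i => [_|i lt_i] /=.
  rewrite /descent /= (nth_map 0) ?sz_v //.
  have := mem_permword (nth 0 v 0) pv; rewrite mem_nth ?sz_v // nth0.
  by rewrite /c; case: (d); rewrite /bump; lia.
rewrite -IHds // /descent /= !(nth_map 0) ?sz_v //; last lia.
by rewrite /bump; lia.
Qed.

(** The new first letter is in no inversion when it is 1. Otherwise it exceeds only letters
    [v_j <= v_0], which lie in the first decreasing run of [v], and the new descent extends that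
    run. *)
Lemma layered_layered_word ds : layered (layered_word ds).
Proof.
elim: ds => [|d ds IHds]; first by move=> i [|j] /andP[].
have sz_v : size (layered_word ds) = (size ds).+1 by apply: size_layered_word.
have pv := layered_word_permword ds.
move=> i [//|j]; rewrite size_layered_word [size _]/= => /andP[lt_ij lt_j].
have dsc k : k.+1 < j.+1 -> descent (layered_word ds) k ->
    descent (layered_word (d :: ds)) k.+1.
  by move=> lt_k; rewrite !descent_layered_word //=; lia.
move=> /= lt_w k /andP[le_ik lt_kj].
case: i lt_ij le_ik lt_w => [_ _|i lt_ij le_ik] /=; last first.
  rewrite !(nth_map 0) ?sz_v; [|simpl in *; lia..] => lt_w.
  case: k le_ik lt_kj => // k le_ik lt_kj; apply: dsc => //.
  by apply: (IHds i j); simpl in *; rewrite /bump in lt_w *; lia.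
rewrite (nth_map 0) ?sz_v; last by simpl in *; lia.
have := mem_permword (nth 0 (layered_word ds) j) pv.
rewrite mem_nth ?sz_v //; case: d lt_j dsc => lt_j dsc /= v_gt0; last first.
  by rewrite /bump; lia.
move=> lt_w; case: k lt_kj => [_|k lt_kj].
  rewrite -[descent _ _]/(descent (layered_word (true :: ds)) 0).
  by rewrite descent_layered_word.
apply: dsc => //; case: (posnP j) => [j0|j_gt0]; first by rewrite j0 in lt_kj.
apply: (IHds 0 j); rewrite ?sz_v ?j_gt0 //.
have: nth 0 (layered_word ds) j != nth 0 (layered_word ds) 0.
  by rewrite nth_uniq ?sz_v ?permword_uniq // gtn_eqF.
by move: lt_w; rewrite nth0 /bump; lia.
Qed.

Lemma desc_layered_word ds w : size w = (size ds).+1 ->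
  (forall i, i < size ds -> descent w i = nth false ds i) ->
  desc (layered_word ds) = desc w.
Proof.
move=> sz_w dw; apply/eq_descP; rewrite size_layered_word // => i lt_i.
by rewrite descent_layered_word // dw.
Qed.

Definition descents (w : seq nat) : seq bool := mkseq (descent w) (size w).-1.

(** If [w] is lsd, the layered word with the same descents competes with it and is itself minimal,
    so antisymmetry identifies the two. *)
Lemma lsdP w : is_permword w -> reflect (layered w) (lsd w).
Proof.
move=> pw; apply: (iffP idP) => [/allP lsd_w|Lw]; last first.
  apply/allP => t; rewrite mem_filter mem_permutations => /andP[/eqP eq_d pt].
  have sz_t : size t = size w by rewrite (perm_size pt) size_iota.
  by apply: layered_lexle; rewrite // /is_permword sz_t.
case: (posnP (size w)) => [/size0nil->|w_gt0]; first by move=> i j /andP[].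
set v := layered_word (descents w).
have sz_v : size v = size w by rewrite size_layered_word size_mkseq prednK.
have eq_d : desc v = desc w.
  apply: desc_layered_word; rewrite size_mkseq ?prednK // => i lt_i.
  by rewrite nth_mkseq.
have pv : is_permword v by apply: layered_word_permword.
have Lv : layered v by apply: layered_layered_word.
suff -> : w = v by [].
apply: lexle_anti; rewrite (layered_lexle pv) // andbT lsd_w //.
by rewrite mem_filter eq_d eqxx mem_permutations /= -sz_v.
Qed.

(** * The terms of the product of two words *)

Lemma mem_words k L w : (w \in words k L) = (size w == k) && all (mem L) w.
Proof.
elim: k w => [|k IHk] [|x w] //=.
  by apply/allpairsP => -[[y v] /= [_ _]].
rewrite eqSS andbCA -IHk; apply/allpairsP/andP => [[[y v] /= [Ly kv [-> ->]]]|].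
  by split.
by case=> Lx kw; exists (x, w).
Qed.

Lemma words_uniq k L : uniq L -> uniq (words k L).
Proof.
move=> UL; elim: k => //= k IHk; apply: allpairs_uniq => //.
by move=> [x v] [y w] _ _ /= [-> ->].
Qed.

(** The pair [(u, v)] is recovered from its concatenation by cutting after [size s] letters. *)
Lemma mem_mprod_terms s t w : (w \in mprod_terms s t) =
  [&& perm_eq w (iota 1 (size s + size t)), st (take (size s) w) == s
    & st (drop (size s) w) == t].
Proof.
apply/mapP/and3P => [[[u v]]|[pw /eqP st_u /eqP st_v]].
  rewrite mem_filter => /andP[/and3P[/= puv su sv]] /allpairsP[[u' v'] /=].
  rewrite !mem_words => -[/andP[/eqP szu _] _ [eq_u _]] ->.
  by rewrite eq_u in puv su *; rewrite take_size_cat ?drop_size_cat.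
exists (take (size s) w, drop (size s) w); rewrite /= ?cat_take_drop //.
rewrite mem_filter /= cat_take_drop pw st_u st_v !eqxx /=.
have sub : {subset w <= iota 1 (size s + size t)}.
  by move=> x; rewrite (perm_mem pw).
apply/allpairsP; exists (take (size s) w, drop (size s) w).
have sz_w : size w = size s + size t by rewrite (perm_size pw) size_iota.
split=> //=; rewrite mem_words.
  by rewrite size_takel ?sz_w ?leq_addr // eqxx; apply/allP => x /mem_take/sub.
by rewrite size_drop sz_w addKn eqxx; apply/allP => x /mem_drop/sub.
Qed.

Lemma mprod_terms_uniq s t : uniq (mprod_terms s t).
Proof.
rewrite map_inj_in_uniq; last first.
  move=> [u v] [u' v']; rewrite !mem_filter /=.
  move=> /andP[_ /allpairsP[[u1 v1] /= [uP _ [-> ->]]]].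
  move=> /andP[_ /allpairsP[[u2 v2] /= [uP' _ [-> ->]]]] /eqP.
  move: uP uP'; rewrite !mem_words => /andP[/eqP <- _] /andP[/eqP sz _].
  by rewrite eqseq_cat // => /andP[/eqP -> /eqP ->].
apply/filter_uniq/allpairs_uniq; rewrite ?words_uniq ?iota_uniq //.
by move=> [u v] [u' v'] _ _ /= [-> ->].
Qed.

Lemma mprod_terms_permword s t w : w \in mprod_terms s t -> is_permword w.
Proof.
rewrite mem_mprod_terms => /andP[pw _].
by rewrite /is_permword (perm_size pw) size_iota.
Qed.

Lemma size_mprod_terms s t w :
  w \in mprod_terms s t -> size w = size s + size t.
Proof. by rewrite mem_mprod_terms => /andP[/perm_size -> _]; apply: size_iota. Qed.

Lemma mprod_terms_nill t : is_permword t -> perm_eq (mprod_terms [::] t) [:: t].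
Proof.
move=> pt; apply: uniq_perm => //; first exact: mprod_terms_uniq.
move=> w; rewrite mem_mprod_terms take0 drop0 inE eqxx /= add0n.
apply/andP/eqP => [[pw /eqP <-]|->]; last by rewrite st_permword_id // eqxx.
by rewrite st_permword_id // /is_permword (perm_size pw) size_iota.
Qed.

Lemma mprod_terms_nilr s : is_permword s -> perm_eq (mprod_terms s [::]) [:: s].
Proof.
move=> ps; apply: uniq_perm => //; first exact: mprod_terms_uniq.
move=> w; rewrite mem_mprod_terms inE addn0.
apply/and3P/eqP => [[pw /eqP]|->].
  rewrite take_oversize ?(perm_size pw) ?size_iota // st_permword_id //.
  by rewrite /is_permword (perm_size pw) size_iota.
by rewrite take_size drop_size st_permword_id ?eqxx.
Qed.

Lemma desc_st u : desc (st u) = desc u.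
Proof.
by apply/eq_descP; rewrite ?size_st // => i lt_i; rewrite descent_st.
Qed.

(** The boolean multiplicity in [nseq] inserts the junction [m] exactly when there is a descent at
    it. *)
Lemma desc_split m w : 0 < m < size w ->
  desc w = desc (take m w) ++ nseq (descent w m.-1) m
           ++ map (addn m) (desc (drop m w)).
Proof.
move=> /andP[m_gt0 lt_m].
rewrite {1}/desc (_ : (size w).-1 = m.-1 + (1 + (size w - m).-1)); last lia.
rewrite !iotaD !filter_cat; congr (_ ++ (_ ++ _)).
- rewrite /desc size_takel; last lia.
  apply: eq_in_filter => i; rewrite mem_iota => lt_i.
  by rewrite !nth_take //; lia.
- rewrite add1n prednK //= /descent prednK //.
  by case: ltnP.
rewrite /desc size_drop (_ : 1 + m.-1 + 1 = m + 1); last lia.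
rewrite iotaDl filter_map; congr map; apply: eq_in_filter => i /=.
rewrite mem_iota /= => i_bnd; rewrite !nth_drop.
by rewrite (_ : (m + i).-1 = m + i.-1) //; lia.
Qed.

(** * The two lsd terms of a product *)

Definition layered_join (b : bool) (s t : seq nat) : seq nat :=
  layered_word (descents s ++ b :: descents t).

Section LayeredProduct.

Variables s t : seq nat.
Hypotheses (ps : is_permword s) (pt : is_permword t).
Hypotheses (s_gt0 : 0 < size s) (t_gt0 : 0 < size t).

Lemma desc_mprod_terms w : w \in mprod_terms s t ->
  desc w = desc s ++ nseq (descent w (size s).-1) (size s)
           ++ map (addn (size s)) (desc t).
Proof.
move=> w_in; have sz_w := size_mprod_terms w_in.
move: w_in; rewrite mem_mprod_terms => /and3P[_ /eqP st_u /eqP st_v].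
rewrite -[in desc s]st_u -[in desc t]st_v !desc_st; apply: desc_split.
by rewrite s_gt0 sz_w; lia.
Qed.

Lemma mprod_terms_lsd w : w \in mprod_terms s t -> lsd w -> lsd s /\ lsd t.
Proof.
move=> w_in; have pw := mprod_terms_permword w_in.
move=> /(lsdP pw) Lw; move: w_in.
rewrite mem_mprod_terms => /and3P[_ /eqP st_u /eqP st_v].
split; apply/lsdP => //.
  by rewrite -st_u; apply/layered_st/layered_take.
by rewrite -st_v; apply/layered_st/layered_drop.
Qed.

Lemma size_layered_join b : size (layered_join b s t) = size s + size t.
Proof.
by rewrite size_layered_word size_cat /= !size_mkseq; lia.
Qed.

Lemma descent_layered_join b i : i.+1 < size s + size t ->
  descent (layered_join b s t) i =
    if i.+1 < size s then descent s i
    else if i.+1 == size s then b else descent t (i - size s).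
Proof.
move=> lt_i; rewrite descent_layered_word; last first.
  by rewrite size_cat /= !size_mkseq; lia.
rewrite nth_cat size_mkseq; case: ifP => lt_is.
  by rewrite nth_mkseq // ifT //; lia.
rewrite ifF; last lia.
case: eqP => [eq_is|ne_is]; first by rewrite (_ : i - _ = 0) //; lia.
rewrite (_ : i - _ = (i - size s).+1); last lia.
by rewrite /= nth_mkseq //; lia.
Qed.

(** Each factor of the join standardizes to a layered permutation with the descents of [s],
    respectively [t]; [layered_inj] then gives equality. *)
Lemma layered_join_mprod_terms b : lsd s -> lsd t ->
  layered_join b s t \in mprod_terms s t.
Proof.
move=> /(lsdP ps) Ls /(lsdP pt) Lt; set w := layered_join b s t.
have sz_w : size w = size s + size t by apply: size_layered_join.
have pw : is_permword w by apply: layered_word_permword.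
have Uw := permword_uniq pw.
have Lw : layered w by apply: layered_layered_word.
rewrite mem_mprod_terms -sz_w; apply/and3P; split=> //; apply/eqP.
  have sz_u : size (take (size s) w) = size s by rewrite size_takel ?sz_w ?leq_addr.
  apply: layered_inj; rewrite ?size_st ?st_permword ?take_uniq //.
    rewrite desc_st; apply/eq_descP => // i; rewrite sz_u => lt_i.
    rewrite /descent !nth_take ?(ltnW lt_i) //.
    rewrite -[LHS]/(descent w i) descent_layered_join ?lt_i //; lia.
  exact/layered_st/layered_take.
have sz_v : size (drop (size s) w) = size t by rewrite size_drop sz_w addKn.
apply: layered_inj; rewrite ?size_st ?st_permword ?drop_uniq //.
  rewrite desc_st; apply/eq_descP => // i; rewrite sz_v => lt_i.
  rewrite /descent !nth_drop addnS.
  rewrite -[LHS]/(descent w _) descent_layered_join; last lia.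
  by rewrite addKn !ifF //; lia.
exact/layered_st/layered_drop.
Qed.

(** The descents of a term are fixed by [s] and [t] except at the junction, so a layered term is one
    of the two joins. *)
Lemma filter_lsd_mprod_terms : lsd s -> lsd t ->
  perm_eq [seq w <- mprod_terms s t | lsd w]
          [:: layered_join true s t; layered_join false s t].
Proof.
move=> lsd_s lsd_t; have jP b := layered_join_mprod_terms b lsd_s lsd_t.
have dj b : descent (layered_join b s t) (size s).-1 = b.
  by rewrite descent_layered_join prednK // ?ltnn ?eqxx //; lia.
apply: uniq_perm; first exact/filter_uniq/mprod_terms_uniq.
  rewrite /= inE andbT; apply/eqP => eq_j.
  by have := dj true; rewrite eq_j dj.
move=> w; rewrite mem_filter !inE; apply/andP/orP => [[lsd_w w_in]|].
  suff -> : w = layered_join (descent w (size s).-1) s t.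
    by case: (descent w _); [left|right].
  have pw := mprod_terms_permword w_in.
  apply: layered_inj => //.
  - exact: layered_word_permword.
  - by rewrite size_layered_join (size_mprod_terms w_in).
  - by rewrite (desc_mprod_terms w_in) (desc_mprod_terms (jP _)) dj.
  - exact/lsdP.
  exact: layered_layered_word.
have lsd_j b : lsd (layered_join b s t).
  by apply/lsdP; [apply: layered_word_permword|apply: layered_layered_word].
by case=> /eqP ->.
Qed.

Lemma desc_layered_join b : lsd s -> lsd t ->
  desc (layered_join b s t) =
    desc s ++ nseq b (size s) ++ map (addn (size s)) (desc t).
Proof.
move=> lsd_s lsd_t.
rewrite (desc_mprod_terms (layered_join_mprod_terms b lsd_s lsd_t)).
by rewrite descent_layered_join prednK // ?ltnn ?eqxx //; lia.
Qed.

End LayeredProduct.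

(** * Compositions of joined descent sets *)

Lemma pairmap_subn_addn m a (E : seq nat) :
  pairmap (fun x y => y - x) (m + a) (map (addn m) E)
  = pairmap (fun x y => y - x) a E.
Proof. by elim: E a => //= e E IHE a; rewrite IHE subnDl. Qed.

Lemma compD_cat m n (D E : seq nat) : 0 < m -> 0 < n ->
  compD (m + n) (D ++ m :: map (addn m) E) = compD m D ++ compD n E.
Proof.
case: m => // m _; case: n => // n _; rewrite addSn /compD.
rewrite -cat_rcons rcons_cat pairmap_cat last_rcons; congr (_ ++ _).
by rewrite -addSn -map_rcons -[X in pairmap _ X]addn0 pairmap_subn_addn.
Qed.

(** Without a descent at the junction, the last part [x] and the first part [y] merge. The bound on
    [last 0 D] keeps the truncated subtraction giving [x] exact. *)
Lemma compD_join m n (D E : seq nat) : 0 < m -> 0 < n -> last 0 D <= m ->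
  exists a x y b, [/\ compD m D = rcons a x, compD n E = y :: b
    & compD (m + n) (D ++ map (addn m) E) = a ++ (x + y) :: b].
Proof.
case: m => // m _; case: n => // n _ le_D; rewrite addSn /compD -addSn.
rewrite rcons_cat -map_rcons.
have [e [E' ->]] : exists e E', rcons E n.+1 = e :: E'.
  by case: E => [|e E]; [exists n.+1, [::] | exists e, (rcons E n.+1)].
rewrite pairmap_cat /= pairmap_subn_addn subn0 -cats1 pairmap_cat cats1 /=.
do 4!eexists; split; [reflexivity..|].
by rewrite addnC -addnBA // addnC.
Qed.

Local Open Scope ring_scope.

(** * The ribbon product rule *)

(** The size bound makes the exponent in [Rg] a true difference; nonemptiness excludes the default
    branch of [coarsenings]. *)
Lemma size_coarsenings a b : b \in coarsenings a ->
  (size b <= size a)%N /\ (0 < size b)%N = (0 < size a)%N.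
Proof.
elim: a b => [|x a IHa] b /=; first by rewrite inE => /eqP ->.
case/flattenP => l /mapP[c /IHa[le_c _] ->].
by case: c le_c => [|y c] /= le_c; rewrite !inE; [|case/orP] => /eqP -> /=; split=> //; lia.
Qed.

Lemma coarsenings_cons x a : coarsenings (x :: a) =
  flatten [seq (if b is y :: b' then [:: x :: b; (x + y)%N :: b']
                else [:: [:: x]]) | b <- coarsenings a].
Proof. by []. Qed.

Definition add_head (x : nat) (b : seq nat) : seq nat :=
  if b is y :: b' then (x + y)%N :: b' else [:: x].

Lemma coarsenings_add_head x y a :
  coarsenings ((x + y)%N :: a) = map (add_head x) (coarsenings (y :: a)).
Proof.
rewrite /= map_flatten -map_comp; congr flatten; apply: eq_map.
by case=> [|z c] //=; rewrite addnA.
Qed.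

Lemma sum_coarsenings (V : zmodType) (F : seq nat -> V) x y a :
  \sum_(b <- coarsenings [:: x, y & a]) F b =
    \sum_(b <- coarsenings (y :: a)) F (x :: b)
    + \sum_(b <- coarsenings ((x + y)%N :: a)) F b.
Proof.
rewrite coarsenings_add_head big_map -big_split.
rewrite coarsenings_cons big_flatten big_map.
apply: eq_big_seq => b /size_coarsenings[_].
by case: b => [|z b] // _; rewrite big_cons big_seq1.
Qed.

Lemma Rg_nil : Rg [::] = 1.
Proof. by rewrite /Rg big_seq1 /Scomp big_nil mulr1. Qed.

Lemma Rg_seq1 x : Rg [:: x] = Sg x.
Proof. by rewrite /Rg big_seq1 /Scomp big_seq1 subnn mul1r. Qed.

(** A coarsening either keeps [x] as its first part or merges it with what follows; merging shortens
    the composition by one, whence the minus sign. *)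
Lemma Rg_cons2 x y a :
  Rg [:: x, y & a] = Sg x * Rg (y :: a) - Rg ((x + y)%N :: a).
Proof.
rewrite /Rg sum_coarsenings; congr (_ + _).
  rewrite mulr_sumr; apply: eq_bigr => b _.
  by rewrite /= subSS /Scomp big_cons !mulrA commr_sign.
rewrite -sumrN; apply: eq_big_seq => b /size_coarsenings[/= le_b _].
by rewrite subSn // exprS mulN1r mulNr.
Qed.

(** Peel off the first part with [Rg_cons2]. The induction is on the length of [a], since the merged
    term has a new head. *)
Lemma Rg_mul a x y b :
  Rg (rcons a x) * Rg (y :: b) =
    Rg (rcons a x ++ y :: b) + Rg (a ++ (x + y)%N :: b).
Proof.
have [n le_an] := ubnP (size a); elim: n a x le_an => // n IHn a x.
case: a => [_|z [|z' a] /= le_an].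
- by rewrite /= Rg_cons2 Rg_seq1 subrK.
(* Here [z] merges with [x] itself, so the induction hypothesis is also used with last part
   [z + x]. *)
- rewrite /= Rg_cons2 (Rg_cons2 z x (y :: b)) (Rg_cons2 z (x + y)%N).
  rewrite mulrBl -mulrA (IHn [::] x) // (IHn [::] (z + x)%N) //=.
  by rewrite mulrDr opprD addrACA addnA.
have IH1 := IHn (z' :: a) x; have IH2 := IHn ((z + z')%N :: a) x.
rewrite !Rg_cons2 mulrBl -mulrA IH1 // IH2 //=.
by rewrite mulrDr opprD addrACA.
Qed.

(** * Multiplicativity of [psi] *)

Definition psi_word (w : seq nat) : NSymm :=
  if lsd w then Rg (compD (size w) (desc w)) else 0.

Lemma psi_word_nil : psi_word [::] = 1.
Proof. exact: Rg_nil. Qed.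

Lemma last_desc s : (last 0 (desc s) <= size s)%N.
Proof.
case: (lastP (desc s)) (mem_desc s) => // D d mem_D.
rewrite last_rcons; have := mem_D d.
by rewrite mem_rcons mem_head => /esym/andP[/andP[_ /ltnW]].
Qed.

(** For nonempty lsd words, the join with a descent gives the concatenated ribbon of [Rg_mul] and
    the other join the merged one. Empty words have no junction and are treated apart. *)
Lemma sum_psi_word_mprod_terms s t : is_permword s -> is_permword t ->
  \sum_(w <- mprod_terms s t) psi_word w = psi_word s * psi_word t.
Proof.
move=> ps pt; case: (posnP (size s)) => [/size0nil -> | s_gt0].
  rewrite (perm_big _ (mprod_terms_nill pt)) big_seq1 psi_word_nil mul1r //.
case: (posnP (size t)) => [/size0nil -> | t_gt0].
  rewrite (perm_big _ (mprod_terms_nilr ps)) big_seq1 psi_word_nil mulr1 //.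
rewrite /psi_word -big_mkcond -big_filter.
have [/andP[lsd_s lsd_t]|not_lsd] := boolP (lsd s && lsd t); last first.
  transitivity (0 : NSymm).
    rewrite big_filter big_seq_cond big1 // => w /andP[w_in lsd_w].
    by have [ls lt] := mprod_terms_lsd ps pt w_in lsd_w; rewrite ls lt in not_lsd.
  by move: not_lsd; case: (lsd s) (lsd t) => [] []; rewrite ?mul0r ?mulr0.
rewrite lsd_s lsd_t (perm_big _ (filter_lsd_mprod_terms ps pt s_gt0 t_gt0 _ _)) //.
rewrite big_cons big_seq1 !size_layered_join // !desc_layered_join //=.
rewrite compD_cat //.
have [a [x [y [b [-> -> ->]]]]] :=
  compD_join (desc t) s_gt0 t_gt0 (last_desc s).
by rewrite Rg_mul.
Qed.

Lemma psiE x : psi x = mmap (in_alg NSymm) psi_basis x.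
Proof. by apply: eq_bigr => s _; rewrite mulr_algl. Qed.

Lemma psi_is_additive : {morph psi : x y / x - y}.
Proof. by move=> x y; rewrite !psiE mmapB. Qed.

HB.instance Definition _ := GRing.isZmodMorphism.Build MPR NSymm psi psi_is_additive.

(** Scalars are integers, so scaling is an integer multiple and additivity suffices. *)
Lemma psiZ c x : psi (c *: x) = c *: psi x.
Proof. by rewrite -[c]intz !scaler_int raddfMz. Qed.

Lemma psi_mkw w : is_permword w -> psi (mkw w) = psi_word w.
Proof.
move=> pw; rewrite /mkw insubT psiE mmapU /= scale1r mul1r.
by rewrite /psi_basis SubK.
Qed.

Lemma mulrZZ (a b : int) (p q : NSymm) :
  (a *: p) * (b *: q) = (a * b) *: (p * q).
Proof.
rewrite -[a]intz -[b]intz -intrM !scaler_int mulrzAl mulrzAr -mulrzA.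
by rewrite mulrC.
Qed.

Lemma psi_mprod_basis s t : psi (mprod_basis s t) = psi_basis s * psi_basis t.
Proof.
rewrite raddf_sum /= -[RHS]sum_psi_word_mprod_terms ?(valP s) ?(valP t) //.
by apply: eq_big_seq => w /mprod_terms_permword /psi_mkw.
Qed.

Lemma psi_mprmul x y : psi (mprmul x y) = psi x * psi y.
Proof.
rewrite raddf_sum [psi x]/psi mulr_suml; apply: eq_bigr => s _.
rewrite raddf_sum [psi y]/psi mulr_sumr; apply: eq_bigr => t _.
by rewrite /= psiZ psi_mprod_basis mulrZZ.
Qed.

Lemma psi_mpr1 : psi mpr1 = 1.
Proof. by rewrite psi_mkw // psi_word_nil. Qed.

(** * The retraction: endomorphisms fixing every [Sg n] *)

Lemma lsd_iota n : lsd (iota 1 n).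
Proof.
apply/lsdP; first by rewrite /is_permword size_iota.
move=> i j; rewrite size_iota => /andP[lt_ij lt_j].
by rewrite !nth_iota ?(ltn_trans lt_ij) //; lia.
Qed.

Lemma desc_iota n : desc (iota 1 n) = [::].
Proof.
apply/eqP; rewrite -[_ == _]negbK -has_filter; apply/hasPn => i.
rewrite mem_iota size_iota => i_bnd; rewrite !nth_iota; lia.
Qed.

Lemma psi_word_iota n : psi_word (iota 1 n) = Sg n.
Proof.
rewrite /psi_word lsd_iota desc_iota size_iota.
by case: n => [|n]; rewrite ?Rg_nil //= subn0 Rg_seq1.
Qed.

Lemma Sg0 : Sg 0 = 1.
Proof. by []. Qed.

Lemma nth_Sseq n j : (j <= n)%N -> nth 0 (Sseq n) j = Sg (n - j).
Proof.
by elim: n j => [|n IHn] [|j] // le_j; rewrite subSS -IHn.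
Qed.

Lemma SgS n :
  Sg n.+1 = \sum_(j < n.+1) (-1) ^+ j * Sg (n - j) * Zg j.+1.
Proof. by apply: eq_bigr => j _; rewrite nth_Sseq // -ltnS. Qed.

Section FixSg.

Variable f : {rmorphism NSymm -> NSymm}.
Hypothesis fS : forall n, f (Sg n) = Sg n.

(* The recursion for [Sg n] expresses [Zg n], up to sign, through the [Sg i]
   and the [Zg j] with [j < n]. *)
Lemma rmorph_fix_Zg n : f (Zg n) = Zg n.
Proof.
elim/ltn_ind: n => -[|n] IHn; first exact: rmorph1.
have := fS n.+1; rewrite SgS big_ord_recr rmorphD subnn Sg0 mulr1 rmorph_sum.
rewrite (eq_bigr (fun j : 'I_n => (-1) ^+ j * Sg (n - j) * Zg j.+1)).
  by move/addrI; rewrite rmorphM rmorph_sign => /(can_inj (signrMK n)).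
move=> j _; rewrite !rmorphM rmorph_sign fS IHn //; exact: (ltn_ord j).
Qed.

(** A monomial is a product of generators, its letter [k] standing for [Zg k.+1]. *)
Lemma rmorph_fix_monomial (m : {fmonom nat}) : f << m >> = << m >>.
Proof.
case: m => s; elim: s => [|k s IHs]; first by rewrite -fmoneE; apply: rmorph1.
have -> : << FMonom (k :: s) >> = Zg k.+1 * << FMonom s >> :> NSymm.
  rewrite malgM_def fgmulUU mulr1; congr << _ *g _ >>.
  by rewrite fmuE; apply/esym/fmmulE.
by rewrite rmorphM rmorph_fix_Zg IHs.
Qed.

Lemma rmorph_fix_Sg a : f a = a.
Proof.
rewrite (monalgE a) rmorph_sum; apply: eq_bigr => m _.
rewrite -[mcoeff m a]intz -[_%:~R]/(1 *~ _) raddfMz /=.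
by rewrite rmorphMz rmorph_fix_monomial.
Qed.

End FixSg.

Theorem theorem14p2 :
  (* psi is a morphism of algebras (MPR, m') -> NSymm *)
  (forall x y : MPR, psi (x + y) = psi x + psi y) /\
  psi mpr1 = 1 /\
  (forall x y : MPR, psi (mprmul x y) = psi x * psi y) /\
  (* psi o i = id for the algebra morphism i determined by i(S_n) = [1..n] *)
  (forall i : NSymm -> MPR,
     (forall a b : NSymm, i (a + b) = i a + i b) ->
     i 1 = mpr1 ->
     (forall a b : NSymm, i (a * b) = mprmul (i a) (i b)) ->
     (forall n : nat, i (Sg n) = mkw (iota 1 n)) ->
     forall a : NSymm, psi (i a) = a).
Proof.
split; first exact: raddfD.
split; first exact: psi_mpr1.
split; first exact: psi_mprmul.
move=> i iD i1 iM iS.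
(* The structure asks for compatibility with differences while [i] respects sums; [a] is written as
   [(a - b) + b]. *)
have f_add : zmod_morphism (psi \o i).
  move=> a b; rewrite -[in RHS](subrK b a) /= (iD (a - b) b) raddfD /=.
  by rewrite addrK.
have f_mul : monoid_morphism (psi \o i).
  by split=> [|a b] /=; rewrite ?i1 ?psi_mpr1 // iM psi_mprmul.
pose f : {rmorphism NSymm -> NSymm} :=
  HB.pack (psi \o i) (GRing.isZmodMorphism.Build _ _ (psi \o i) f_add)
    (GRing.isMonoidMorphism.Build _ _ (psi \o i) f_mul).
apply: (@rmorph_fix_Sg f) => n.
by rewrite /= iS psi_mkw ?psi_word_iota // /is_permword size_iota.
Qed.
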